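(* Let $p\ge 2$ be an integer, let $\Omega\subseteq\{0,1,\dots,r-1\}^{\mathbb{N}}$ be a subshift, and let $X^p_\Omega$ be the associated 2-multiplicative integer system on $\mathbb{N}$. For every $h\in\left[h(X^p_\Omega),\log|\Omega_1|\right]$ there is a real number $\tau$ such that $h$ is realized as a boundary complexity with speed $\tau$; that is, there are a $\tau$ and a function $\mathbf{f}=f_1$ with $\lim_{m\to\infty} f_1(m)/m=\tau$ such that $h^{\mathbf{f}}(X^p_\Omega)=h$.
   Context: $\mathbb{N}=\{1,2,\dots\}$. The 2-multiplicative integer system is $X^p_\Omega=\{(x_i)_{i\in\mathbb{N}}\in\{0,\dots,r-1\}^{\mathbb{N}}: (x_{ip^\ell})_{\ell=0}^\infty\in\Omega \text{ for all } i\in\mathbb{N}\}$. $\Omega_\ell$ denotes the set of admissible blocks of length $\ell$ of $\Omega$. For a finite set $F\subset\mathbb{N}$, $\mathcal{P}(F,X)=\{(x_i)_{i\in F}:x\in X\}$. For a function $f_1$ on $\mathbb{N}$ with values in the nonnegative integers, let $F_m(\mathbf{f})=\{1,\dots,m\}\setminus\{1,\dots,f_1(m)\}$; the boundary complexity is $h^{\mathbf{f}}(X)=\lim_{m\to\infty}\frac{\log|\mathcal{P}(F_m(\mathbf{f}),X)|}{|F_m(\mathbf{f})|}$, whenever the limit exists. The topological entropy is $h(X)=\lim_{m\to\infty}\frac1m\log|\mathcal{P}(\{1,\dots,m\},X)|$.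
   Formalization: ''Subshift'' is taken to mean a nonempty closed set Ω with σ(Ω)=Ω; if only σ(Ω)⊆Ω were required the claim would fail, e.g. for Ω={0^∞, 10^∞}, where h=log 2=log|Ω_1| is not realized by any f_1. *)

(* Defs.v *)
From mathcomp Require Import all_boot all_order all_algebra.
From mathcomp Require Import finmap.
From mathcomp Require Import all_classical all_reals all_analysis.

Set Implicit Arguments.
Unset Strict Implicit.
Unset Printing Implicit Defensive.

Import Order.TTheory GRing.Theory Num.Theory.
Import numFieldNormedType.Exports.

Local Open Scope classical_set_scope.
Local Open Scope ring_scope.

(* {0, ..., r-1}^N with the product of the discrete topologies.  For the shift
   space the index nat plays the role of l = 0, 1, 2, ... *)
Definition sequence_space (r : nat) : Type :=
  prod_topology (fun _ : nat => discrete_topology 'I_r).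

Definition shift (r : nat) (x : sequence_space r) : sequence_space r :=
  fun l => x l.+1.

(* Invariance is the equality shift(Omega) = Omega, so that a block occurring
   in a point of Omega occurs at every position of some point of Omega; the
   inclusion alone would not give this in the one-sided setting. *)
Definition subshift (r : nat) (Omega : set (sequence_space r)) : Prop :=
  [/\ Omega !=set0, closed Omega & @shift r @` Omega = Omega].

Definition blocks (r : nat) (Omega : set (sequence_space r)) (l : nat) :
    {set l.-tuple 'I_r} :=
  [set w : l.-tuple 'I_r | `[< exists2 x, Omega x &
     exists k : nat, forall j : 'I_l, tnth w j = x (k + j)%N >]]%SET.

(* A configuration on {1, 2, ...} is a function on nat whose value at 0 is a
   dummy: it is not constrained here, and below only the restrictions to sets
   of positive integers are counted. *)
Definition multiplicative_system (p r : nat) (Omega : set (sequence_space r)) :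
    set (nat -> 'I_r) :=
  [set x | forall i : nat, (0 < i)%N -> Omega (fun l => x (i * p ^ l)%N)].

Definition patterns (r : nat) (F : {fset nat}) (X : set (nat -> 'I_r)) :
    {set {ffun F -> 'I_r}} :=
  [set y : {ffun F -> 'I_r} | `[< exists2 x, X x &
     forall i : F, y i = x (fsval i) >]]%SET.

Definition interval1 (m : nat) : {fset nat} :=
  [fset i in iota 1 m]%fset.

Definition boundary_window (f : nat -> nat) (m : nat) : {fset nat} :=
  (interval1 m `\` interval1 (f m))%fset.

Definition topological_entropy (R : realType) (r : nat)
    (X : set (nat -> 'I_r)) : R :=
  limn (fun m : nat => ln (#|patterns (interval1 m) X|%:R : R) / m%:R).

(* The limit defining the boundary complexity exists and equals h.  The
   windows have to be eventually nonempty for the quotient to make sense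
   (division by zero returns 0 here). *)
Definition has_boundary_complexity (R : realType) (r : nat) (f : nat -> nat)
    (X : set (nat -> 'I_r)) (h : R) : Prop :=
  (\forall m \near \oo, boundary_window f m != fset0) /\
  (fun m : nat => ln (#|patterns (boundary_window f m) X|%:R : R)
                  / (#|` boundary_window f m|)%fset%:R) @ \oo --> h.

Definition has_speed (R : realType) (f : nat -> nat) (tau : R) : Prop :=
  (fun m : nat => (f m)%:R / m%:R : R) @ \oo --> tau.

(* Main.v *)
(* Write |P(n,m]| for the number of patterns on {n+1, ..., m}, a_k for the
   logarithm of the number of k-blocks of Omega, and G(n,m) = ln |P(n,m]|.  The
   chain s, sp, sp^2, ... of s = n+1 meets (n,m] in its first k+1 terms when
   s p^k <= m < s p^(k+1), and it is independent of the rest of the window, so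
   removing s gives G(n,m) - G(n+1,m) = a_(k+1) - a_k, which does not depend on
   n otherwise.  Hence G(floor(tau m), m) / m converges to a function of tau
   that is affine on each interval [p^-(k+1), p^-k], and G(0,m)/m is within
   a_1 p^-k of G(floor(m/p^k), m)/m.  The ratio at tau = 1/p is a_1, the ratios
   at p^-k tend to the entropy, and a value h strictly above the entropy is
   therefore crossed between two consecutive powers, where a linear equation
   gives tau; the entropy itself is realised by f = 0. *)
Require Import Defs.
From mathcomp Require Import all_boot all_order all_algebra.
From mathcomp Require Import finmap zify ring lra.
From mathcomp Require Import all_classical all_reals all_analysis.
Set Implicit Arguments.
Unset Strict Implicit.
Unset Printing Implicit Defensive.

Import Order.TTheory GRing.Theory Num.Theory.
Import numFieldNormedType.Exports.
Local Open Scope ring_scope.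

(** * Counting the images of a set under maps into finite types *)

Section FiniteImages.
Context {W : Type} (X : set W).

Definition fimage {T : finType} (u : W -> T) : {set T} :=
  [set y | `[< exists2 x, X x & u x = y >]]%SET.

Lemma fimageP {T : finType} (u : W -> T) (y : T) :
  reflect (exists2 x, X x & u x = y) (y \in fimage u).
Proof. by rewrite inE; exact: asboolP. Qed.

Lemma mem_fimage {T : finType} (u : W -> T) (x : W) : X x -> u x \in fimage u.
Proof. by move=> Xx; apply/fimageP; exists x. Qed.

(** On [X] the map [u] factors through [v], so the image of [u] is covered by the image of [v] under
    the factor map. *)
Lemma leq_card_fimage {T U : finType} (u : W -> T) (v : W -> U) :
  (forall x y, X x -> X y -> v x = v y -> u x = u y) ->
  (#|fimage u| <= #|fimage v|)%N.
Proof.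
move=> uv.
have [->|[_ /fimageP[x0 Xx0 _]]] := set_0Vmem (fimage u); first by rewrite cards0.
(* The factor map picks a [v]-preimage in [X]; off the image of [v] the value [u x0] is an arbitrary
   default. *)
pose g t := if pselect (exists2 x, X x & v x = t) is left e
            then u (s2val (cid2 e)) else u x0.
suff sub : fimage u \subset [set g t | t in fimage v].
  by apply: leq_trans (subset_leq_card sub) (leq_imset_card _ _).
apply/fintype.subsetP => _ /fimageP[x Xx <-]; apply/imsetP.
exists (v x); first exact: mem_fimage.
rewrite /g; case: pselect => [e|[]]; last by exists x.
by case: cid2 => y Xy vy /=; exact: uv.
Qed.

Lemma card_fimage_eq {T U : finType} (u : W -> T) (v : W -> U) :
  (forall x y, X x -> X y -> u x = u y <-> v x = v y) ->
  #|fimage u| = #|fimage v|.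
Proof.
move=> uv; apply/eqP; rewrite eqn_leq.
by rewrite !leq_card_fimage// => x y Xx Xy /(uv _ _ Xx Xy).
Qed.

Lemma fimage_pair_subset {T U : finType} (u : W -> T) (v : W -> U) :
  fimage (fun x => (u x, v x)) \subset finset.setX (fimage u) (fimage v).
Proof.
by apply/fintype.subsetP => _ /fimageP[x Xx <-]; rewrite finset.in_setX/= !mem_fimage.
Qed.

Lemma fimage_pair {T U : finType} (u : W -> T) (v : W -> U) :
  (forall x y, X x -> X y -> exists2 z, X z & u z = u x /\ v z = v y) ->
  fimage (fun x => (u x, v x)) = finset.setX (fimage u) (fimage v).
Proof.
move=> indep; apply/eqP; rewrite finset.eqEsubset fimage_pair_subset /=.
apply/fintype.subsetP => -[s t]; rewrite finset.in_setX => /andP[/=].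
move=> /fimageP[x Xx <-] /fimageP[y Xy <-].
by have [z Xz [<- <-]] := indep _ _ Xx Xy; exact: mem_fimage.
Qed.

End FiniteImages.

(** * Patterns as images of restriction maps, and the product rule for independent windows *)

Section Patterns.
Context {r : nat} (X : set (nat -> 'I_r)).
Implicit Types (F A B : {fset nat}).

Definition restr F (x : nat -> 'I_r) : {ffun F -> 'I_r} :=
  [ffun i => x (fsval i)].

Lemma restr_eqP F (x y : nat -> 'I_r) :
  restr F x = restr F y <-> {in F, x =1 y}.
Proof.
split=> [/ffunP e j jF|e]; first by have := e [` jF]%fset; rewrite !ffunE.
by apply/ffunP => i; rewrite !ffunE e// fsvalP.
Qed.

Lemma patternsE F : patterns F X = fimage X (restr F).
Proof.
apply/finset.setP => y; rewrite !inE; apply: asbool_equiv_eq.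
split=> -[x Xx e]; exists x => //; last by move=> i; rewrite -e ffunE.
by apply/ffunP => i; rewrite ffunE e.
Qed.

Lemma card_patternsU F A B :
  F =i [predU A & B] ->
  (forall x y, X x -> X y ->
     exists2 z, X z & {in A, z =1 x} /\ {in B, z =1 y}) ->
  #|patterns F X| = (#|patterns A X| * #|patterns B X|)%N.
Proof.
move=> FE indep; rewrite !patternsE.
rewrite -cardsX -fimage_pair => [|x y Xx Xy]; last first.
  by have [z Xz [zx zy]] := indep _ _ Xx Xy; exists z => //; split; apply/restr_eqP.
apply: card_fimage_eq => x y _ _; rewrite restr_eqP.
split=> [e|[/restr_eqP eA /restr_eqP eB] j].
  by congr pair; apply/restr_eqP => j jF; apply: e; rewrite FE inE jF ?orbT.
by rewrite FE inE => /orP[/eA|/eB].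
Qed.

End Patterns.

(** * Growth of the block counts of a subshift *)

Section Blocks.
Context {r : nat} (Omega : set (sequence_space r)).
Hypothesis hOmega : subshift Omega.

Definition prefix_block l (x : nat -> 'I_r) : l.-tuple 'I_r :=
  [tuple x j | j < l].

Lemma prefix_block_eqP l (x y : nat -> 'I_r) :
  prefix_block l x = prefix_block l y <-> {in gtn l, x =1 y}.
Proof.
split=> [/(congr1 (@tnth _ _)) e j jl|e].
  by have := congr1 (fun g => g (Ordinal jl)) e; rewrite !tnth_mktuple.
by apply/eq_from_tnth => j; rewrite !tnth_mktuple e// inE/=.
Qed.

Lemma subshift_drop k x : Omega x -> Omega (fun l => x (k + l)%N).
Proof.
move=> Ox; elim: k => [//|k IH]; case: hOmega => _ _ <-.
exists (fun l => x (k + l)%N) => //; apply/funext => l.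
exact: (congr1 (x : nat -> 'I_r) (addnS k l)).
Qed.

(** Surjectivity of the shift on [Omega] allows [k] symbols to be prepended. *)
Lemma subshift_extend k x :
  Omega x -> exists2 y, Omega y & forall l, y (k + l)%N = x l.
Proof.
elim: k x => [x Ox|k IH x]; first by exists x.
case: hOmega => _ _ {1}<- -[y /IH[z Oz ze] <-]; exists z => // l.
by rewrite addSnnS ze.
Qed.

(** By shift invariance a block seen at position [k] is also seen at position 0. *)
Lemma blocksE l : blocks Omega l = fimage Omega (prefix_block l).
Proof.
apply/finset.setP => w; rewrite !inE; apply: asbool_equiv_eq; split.
  move=> [x Ox [k e]]; exists (fun j => x (k + j)%N); first exact: subshift_drop.
  by apply/eq_from_tnth => j; rewrite tnth_mktuple e.
by move=> [x Ox <-]; exists x => //; exists 0%N => j; rewrite tnth_mktuple.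
Qed.

Lemma card_blocks0 : #|blocks Omega 0| = 1%N.
Proof.
apply/eqP; rewrite eqn_leq; apply/andP; split.
  by apply: leq_trans (max_card _) _; rewrite card_tuple expn0.
case: hOmega => -[x Ox] _ _; apply/card_gt0P; exists (prefix_block 0 x).
by rewrite blocksE mem_fimage.
Qed.

Lemma leq_card_blocksS l : (#|blocks Omega l| <= #|blocks Omega l.+1|)%N.
Proof.
rewrite !blocksE; apply: leq_card_fimage => x y _ _ /prefix_block_eqP e.
by apply/prefix_block_eqP => j; rewrite inE => jl; apply: e; rewrite inE/= leqW.
Qed.

(** A block of length [l.+1] is determined by its prefix of length [l] and its last letter, which is
    itself a 1-block. *)
Lemma card_blocksS_leq l :
  (#|blocks Omega l.+1| <= #|blocks Omega 1| * #|blocks Omega l|)%N.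
Proof.
pose last1 (x : sequence_space r) := prefix_block 1 (fun j => x (l + j)%N).
have le1 : (#|fimage Omega last1| <= #|blocks Omega 1|)%N.
  apply/subset_leq_card/fintype.subsetP => _ /fimageP[x Ox <-]; rewrite blocksE.
  by apply: (mem_fimage _ (subshift_drop _ Ox)).
apply: leq_trans (leq_mul le1 (leqnn _)); rewrite !blocksE -cardsX.
apply: leq_trans (subset_leq_card (fimage_pair_subset _ _ _)).
apply: leq_card_fimage => x y _ _ xy.
have /prefix_block_eqP el := congr1 fst xy.
have /prefix_block_eqP e := congr1 snd xy.
apply/prefix_block_eqP => j; rewrite inE/= ltnS leq_eqVlt => /predU1P[->|/e//].
by have := el 0%N isT; rewrite addn0.
Qed.

Lemma card_blocks_gt0 l : (0 < #|blocks Omega l|)%N.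
Proof.
by elim: l => [|l IH]; [rewrite card_blocks0|exact: leq_trans (leq_card_blocksS l)].
Qed.

End Blocks.

(** * Windows (n, m] *)

Section Window.
Local Open Scope nat_scope.

(** Written so that [boundary_window f m] is [window (f m) m] by definition. *)
Definition window n m : {fset nat} := (interval1 m `\` interval1 n)%fset.

Lemma in_window n m j : (j \in window n m) = (n < j <= m).
Proof. by rewrite in_fsetD !inE/= !mem_iota !add1n !ltnS; lia. Qed.

Lemma card_window n m : #|` window n m|%fset = m - n.
Proof.
have -> : window n m = [fset j in iota n.+1 (m - n)]%fset.
  by apply/fsetP => j; rewrite in_window !inE/= mem_iota; lia.
by rewrite card_fseq undup_id ?iota_uniq// size_iota.
Qed.

End Window.

(** * Chains s, sp, sp^2, ... and the recursion for pattern counts *)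

Section MultiplicativeSystem.
Local Open Scope nat_scope.
Context {p r : nat} (hp : 2 <= p) (Omega : set (sequence_space r)).
Hypothesis hOmega : subshift Omega.
Let X := multiplicative_system p Omega.

Let expp_gt0 l : 0 < p ^ l.
Proof. by rewrite expn_gt0 (ltn_trans _ hp). Qed.

(* A substitute for the p-adic valuation, which need not come from a prime:
   only the shift along the chains i, ip, ip^2, ... matters. *)
Lemma chain_valuation :
  exists v : nat -> nat, forall i l, 0 < i -> v (i * p ^ l) = v i + l.
Proof.
pose q := pdiv p; exists (fun j => logn q j %/ logn q p) => i l i0.
have lp0 : 0 < logn q p.
  by rewrite -pfactor_dvdn ?expn1 ?pdiv_prime ?pdiv_dvd// (ltn_trans _ hp).
by rewrite lognM// lognX addnC divnMDl// addnC.
Qed.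

(** A configuration [y (v j)] depending only on the valuation [v] reads a tail of [y] along each
    chain, hence lies in [X]. Taking for [y] an extension of [x] by [v s] symbols to the left makes
    the chain of [s] read exactly [x]. *)
Lemma multiplicative_system_extend s x : 0 < s -> Omega x ->
  exists2 z, X z & forall l, z (s * p ^ l) = x l.
Proof.
move=> s0 Ox; have [v vE] := chain_valuation.
have [y Oy yE] := subshift_extend hOmega (v s) Ox.
exists (fun j => y (v j)) => [i i0|l]; last by rewrite vE.
rewrite (_ : (fun l => _) = fun l => y (v i + l)); first exact: subshift_drop hOmega _ _ Oy.
by apply/funext => l; rewrite vE.
Qed.

Lemma multiplicative_system_chain s x :
  0 < s -> X x -> Omega (fun l => x (s * p ^ l)).
Proof. by move=> s0; apply. Qed.

Definition chain s L : {fset nat} := [fset (s * p ^ l)%N | l in iota 0 L]%fset.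

Lemma chainP s L j :
  reflect (exists2 l, l < L & j = s * p ^ l) (j \in chain s L).
Proof.
apply: (iffP (imfsetP _ _ _ _)) => /= -[l lL ->]; exists l => //.
  by rewrite mem_iota in lL.
by rewrite mem_iota.
Qed.

Lemma card_patterns_chain s L :
  0 < s -> #|patterns (chain s L) X| = #|blocks Omega L|.
Proof.
move=> s0; rewrite patternsE blocksE//.
pose block (x : nat -> 'I_r) : L.-tuple 'I_r := prefix_block L (fun l => x (s * p ^ l)).
transitivity #|fimage X block|.
  apply: card_fimage_eq => x y _ _; rewrite restr_eqP prefix_block_eqP.
  split=> [e l lL|e _ /chainP[l lL ->]]; last exact: e.
  by apply: e; apply/chainP; exists l.
congr (#|pred_of_set _|); apply/finset.setP => w; apply/fimageP/fimageP => -[x].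
  move=> Xx <-; exists (fun l => x (s * p ^ l)) => //.
  exact: multiplicative_system_chain.
move=> Ox <-; have [z Xz zE] := multiplicative_system_extend s0 Ox.
by exists z => //; apply/prefix_block_eqP => l _; rewrite zE.
Qed.

(** The set [C] of integers whose chain meets that of [s] is invariant along every chain. Using [x]
    on [C] and [y] elsewhere therefore never mixes the two within one chain. *)
Lemma multiplicative_system_splice s x y : X x -> X y ->
  exists2 z, X z & (forall l, z (s * p ^ l) = x (s * p ^ l)) /\
    (forall j, (forall a b, j * p ^ a <> s * p ^ b) -> z j = y j).
Proof.
move=> Xx Xy; pose C j := `[< exists a b, j * p ^ a = s * p ^ b >].
have CE i l : C (i * p ^ l) = C i.
  rewrite /C; apply: asbool_equiv_eq; split=> -[a [b e]].
    by exists (l + a), b; rewrite expnD mulnA.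
  by exists a, (b + l); rewrite expnD mulnA -e mulnAC.
exists (fun j => if C j then x j else y j) => [i i0|].
  case Ci: (C i).
    rewrite (_ : (fun l => _) = fun l => x (i * p ^ l)); first exact: Xx.
    by apply/funext => l; rewrite CE Ci.
  rewrite (_ : (fun l => _) = fun l => y (i * p ^ l)); first exact: Xy.
  by apply/funext => l; rewrite CE Ci.
split=> [l|j jC]; first by rewrite CE ifT//; apply/asboolP; exists 0, 0.
by rewrite /C; case: asboolP => // -[a [b /jC]].
Qed.

(** With s = n+1, the window (n, m] splits into the k+1 terms s, ..., sp^k and a rest [B]
    independent of them. Removing s leaves the k terms of the chain of sp and the same [B], so the
    factor of [B] is common to both sides. *)
Lemma card_patterns_window_step n m k : n.+1 * p ^ k <= m < n.+1 * p ^ k.+1 ->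
  #|patterns (window n m) X| * #|blocks Omega k| =
  #|patterns (window n.+1 m) X| * #|blocks Omega k.+1|.
Proof.
move=> /andP[km mk]; set s := n.+1 in km mk *.
have s0 : 0 < s by [].
have ple a b : (p ^ a <= p ^ b) = (a <= b) by rewrite leq_exp2l.
have sub j : j \in chain s k.+1 -> s <= j <= m.
  move=> /chainP[l lk ->]; rewrite leq_pmulr//= (leq_trans _ km)//.
  by rewrite leq_pmul2l// ple.
pose B := (window n m `\` chain s k.+1)%fset.
(* If a <= b, then j would be a term of the chain of s not exceeding m, which was removed. If b < a,
   then jp <= s, contradicting j >= s. *)
have BP j : j \in B -> forall a b, j * p ^ a <> s * p ^ b.
  rewrite in_fsetD in_window => /andP[/chainP jC /andP[nj jm]] a b e.
  have [ab|ba] := leqP a b.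
    have je : j = s * p ^ (b - a).
      apply/eqP; rewrite -(eqn_pmul2r (expp_gt0 a)) e -mulnA -expnD subnK//.
    apply: jC; exists (b - a) => //; move: (leq_ltn_trans jm mk).
    by rewrite je ltn_pmul2l// ltn_exp2l.
  have se : j * p ^ (a - b) = s.
    apply/eqP; rewrite -(eqn_pmul2r (expp_gt0 b)) -e -mulnA -expnD subnK// ltnW//.
  have : j * p <= s.
    rewrite -se leq_pmul2l ?(leq_ltn_trans _ nj)//.
    by rewrite -[X in X <= _]expn1 ple subn_gt0.
  by rewrite /s; nia.
have indep x y : X x -> X y -> exists2 z, X z &
    (forall l, z (s * p ^ l) = x (s * p ^ l)) /\ {in B, z =1 y}.
  move=> Xx Xy; have [z Xz [zx zy]] := multiplicative_system_splice s Xx Xy.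
  by exists z => //; split=> // j /BP; exact: zy.
have -> : #|patterns (window n m) X| =
    #|blocks Omega k.+1| * #|patterns B X|.
  rewrite -(card_patterns_chain k.+1 s0); apply: card_patternsU => [j|x y Xx Xy].
    rewrite in_window [RHS]inE/= [X in _ || X]in_fsetD in_window.
    by case: (boolP (j \in chain _ _)) => [/sub|].
  have [z Xz [zx zy]] := indep _ _ Xx Xy; exists z => //; split=> //.
  by move=> _ /chainP[l _ ->].
suff -> : #|patterns (window n.+1 m) X| =
    #|blocks Omega k| * #|patterns B X| by rewrite [LHS]mulnC mulnCA mulnC.
have sp0 : 0 < s * p by rewrite muln_gt0 (ltn_trans _ hp).
rewrite -(card_patterns_chain k sp0); apply: card_patternsU => [j|x y Xx Xy].
  rewrite in_window [RHS]inE/= [X in _ || X]in_fsetD in_window.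
  have -> : (j \in chain (s * p) k) = (j != s) && (j \in chain s k.+1).
    apply/chainP/andP => [[l lk ->]|[js /chainP[[|l] lk je]]].
    - rewrite -mulnA -expnS; split; last by apply/chainP; exists l.+1.
      by rewrite -[X in _ != X]muln1 eqn_pmul2l// -(expn0 p) eqn_exp2l.
    - by rewrite je expn0 muln1 eqxx in js.
    - by exists l => //; rewrite -mulnA -expnS.
  have sC : s \in chain s k.+1 by apply/chainP; exists 0; rewrite ?expn0 ?muln1.
  have [->|js] := eqVneq j s; first by rewrite sC ltnn.
  rewrite ltn_neqAle eq_sym js/=.
  by case: (boolP (j \in chain _ _)) => [/sub|].
have [z Xz [zx zy]] := indep _ _ Xx Xy; exists z => //; split=> //.
by move=> _ /chainP[l _ ->]; rewrite -mulnA -expnS.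
Qed.

Lemma card_patterns_gt0 F : 0 < #|patterns F X|.
Proof.
case: hOmega => -[x Ox] _ _.
have [z Xz _] := multiplicative_system_extend (ltn0Sn 0) Ox.
by apply/card_gt0P; exists (restr F z); rewrite patternsE mem_fimage.
Qed.

(** The empty window is a chain with no terms, and there is one block of length 0. *)
Lemma card_patterns_window_nil m : #|patterns (window m m) X| = 1.
Proof.
have -> : window m m = chain 1 0.
  apply/fsetP => j; rewrite in_window ltnNge andNb.
  by apply/esym/negP => /chainP[].
by rewrite card_patterns_chain// card_blocks0.
Qed.

End MultiplicativeSystem.

(** * Limits of a two-parameter array satisfying the recursion *)

Section Asymptotics.
Local Open Scope classical_set_scope.
Local Open Scope ring_scope.
Context {R : realType} {p : nat} (hp : (2 <= p)%N).
Variables (G : nat -> nat -> R) (a : nat -> R).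
Hypothesis G_nil : forall m, G m m = 0.
Hypothesis G_step : forall n m k,
  (n.+1 * p ^ k <= m < n.+1 * p ^ k.+1)%N ->
  G n m = G n.+1 m + (a k.+1 - a k).
Hypothesis a_0 : a 0 = 0.
Hypothesis a_ndecr : forall k, a k <= a k.+1.
Hypothesis a_incr_le : forall k, a k.+1 - a k <= a 1.

Let d k := a k.+1 - a k.
Let q k : R := p%:R^-1 ^+ k.

Let d_ge0 k : 0 <= d k.
Proof. by rewrite subr_ge0. Qed.

Let a1_ge0 : 0 <= a 1.
Proof. by rewrite -a_0. Qed.

Let p_gt0 : 0 < p%:R :> R.
Proof. by rewrite ltr0n (ltn_trans _ hp). Qed.

Let p_le_half : p%:R^-1 <= 2^-1 :> R.
Proof. by rewrite lef_pV2 ?posrE// ler_nat. Qed.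

Let q_gt0 k : 0 < q k.
Proof. by rewrite exprn_gt0 ?invr_gt0. Qed.

Let qS k : q k.+1 = q k / p%:R.
Proof. exact: exprSr. Qed.

Let qS_le k : q k.+1 <= q k / 2.
Proof. by rewrite qS ler_pM2l. Qed.

Let qVE k (x : R) : x * q k = x / (p ^ k)%:R.
Proof. by rewrite /q exprVn natrX. Qed.

Let expp_gt0 k : 0 < (p ^ k)%:R :> R.
Proof. by rewrite natrX exprn_gt0. Qed.

(** Each s with n < s <= n' satisfies sp^k <= m < sp^(k+1), so every removal costs the same amount
    [d k]. *)
Lemma G_level k m n n' :
  (m < n.+1 * p ^ k.+1)%N -> (n <= n')%N -> (n' * p ^ k <= m)%N ->
  G n m = G n' m + d k * (n'%:R - n%:R).
Proof.
move=> mn /subnKC <-; elim: (n' - n)%N => [|i IH] im.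
  by rewrite addn0 subrr mulr0 addr0.
rewrite IH; last by apply: leq_trans im; rewrite leq_mul// leq_add2l.
rewrite (@G_step (n + i)%N m k); last first.
  rewrite -addnS im/= (leq_trans mn)// leq_mul//; lia.
by rewrite addnS -/(d k) -!natr1 !natrD; ring.
Qed.

(** Each of the n removals costs some [d k], which lies between 0 and [a 1]. *)
Lemma G_head n m : (n <= m)%N -> 0 <= G 0 m - G n m <= a 1 * n%:R.
Proof.
elim: n => [_|n IH nm]; first by rewrite subrr mulr0 lexx.
have m0 : (0 < m %/ n.+1)%N by rewrite divn_gt0.
(* The level of n+1 is the integer part of the base-p logarithm of m/(n+1). *)
have /andP[km mk] := trunc_log_bounds hp m0.
have := IH (ltnW nm); rewrite leq_divRL// in km; rewrite ltn_divLR// in mk.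
rewrite (@G_step n m (trunc_log p (m %/ n.+1))); last by rewrite ![(n.+1 * _)%N]mulnC km.
set k := trunc_log _ _; have := a_incr_le k; have := a_ndecr k.
by rewrite -natr1; nra.
Qed.

Lemma cvg_ratio_floor (x : R) (c : nat -> nat) :
  (forall m, x * m%:R - 1 <= (c m)%:R <= x * m%:R) ->
  (fun m => (c m)%:R / m%:R : R) @ \oo --> x.
Proof.
move=> cE; rewrite -cvg_shiftS.
apply: (@squeeze_cvgr _ _ _ _ (fun m => x - harmonic m) (cst x)); last 2 first.
- by rewrite -[X in _ --> X]subr0; apply: cvgB; [exact: cvg_cst|exact: cvg_harmonic].
- exact: cvg_cst.
near=> m; have := cE m.+1; have m0 : 0 < m.+1%:R :> R by [].
rewrite ler_pdivrMr// ler_pdivlMr// mulrBl /harmonic/= mulVf ?gt_eqF//.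
Unshelve. all: by end_near. Qed.

Lemma cvg_ratio_divn k : (fun m => (m %/ p ^ k)%:R / m%:R : R) @ \oo --> q k.
Proof.
apply: cvg_ratio_floor => m; rewrite mulrC qVE ler_pdivlMr// lerBlDr ler_pdivrMr//.
rewrite -natrM natr1 -natrM !ler_nat leq_trunc_div andbT ltnW// ltn_ceil//.
by rewrite expn_gt0 (ltn_trans _ hp).
Qed.

(** The limit of G(m/p^k, m)/m: a proportion [q j - q j.+1] of the integers up to m has level j. *)
Let phi k := \sum_(j < k) d j * (q j - q j.+1).

Let phiS k : phi k.+1 = phi k + d k * (q k - q k.+1).
Proof. by rewrite /phi big_ord_recr. Qed.

Lemma cvg_G_divn k : (fun m => G (m %/ p ^ k)%N m / m%:R) @ \oo --> phi k.
Proof.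
elim: k => [|k IH].
  rewrite /phi big_ord0; under eq_fun do rewrite expn0 divn1 G_nil mul0r.
  exact: cvg_cst.
have -> : (fun m => G (m %/ p ^ k.+1)%N m / m%:R) = (fun m =>
    G (m %/ p ^ k)%N m / m%:R +
    d k * ((m %/ p ^ k)%:R / m%:R - (m %/ p ^ k.+1)%:R / m%:R)).
  apply/funext => m.
  have pk l : (0 < p ^ l)%N by rewrite expn_gt0 (ltn_trans _ hp).
  rewrite (@G_level k m _ (m %/ p ^ k)) ?leq_trunc_div ?ltn_ceil//; first by ring.
  by rewrite leq_div2l// leq_exp2l.
rewrite phiS; apply: cvgD IH _; apply: cvgMr.
by apply: cvgB; exact: cvg_ratio_divn.
Qed.

Lemma phi_ndecr : {homo phi : m n / (m <= n)%N >-> m <= n}.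
Proof.
apply/nondecreasing_seqP => k; rewrite phiS lerDl mulr_ge0//.
by have := qS_le k; have := q_gt0 k; lra.
Qed.

Lemma phi_le k : phi k <= a 1.
Proof.
(* The sharper bound telescopes, which makes the induction go through. *)
suff : phi k <= a 1 * (1 - q k) by have := mulr_ge0 a1_ge0 (ltW (q_gt0 k)); lra.
elim: k => [|k IH]; first by rewrite /phi big_ord0 /q expr0 subrr mulr0.
have dq : d k * (q k - q k.+1) <= a 1 * (q k - q k.+1).
  by rewrite ler_wpM2r ?a_incr_le//; have := qS_le k; have := q_gt0 k; lra.
by rewrite phiS; lra.
Qed.

Let L := limn phi.

Lemma cvg_phi : phi @ \oo --> L.
Proof.
apply: nondecreasing_is_cvgn; first exact: phi_ndecr.
by exists (a 1) => _ [k _ <-]; exact: phi_le.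
Qed.

Lemma cvg_q : q @ \oo --> 0.
Proof.
apply: cvg_expr; rewrite ger0_norm ?invr_ge0 ?ltW//.
by apply: le_lt_trans p_le_half _; lra.
Qed.

(** First k is fixed so that both [L - phi k] and the head, at most [a 1 * q k] after division by m,
    are small; then m is taken large. *)
Lemma cvg_G0 : (fun m => G 0 m / m%:R) @ \oo --> L.
Proof.
apply/cvgrPdist_lt => e e0.
have e3 : 0 < e / 3 by rewrite divr_gt0.
have c1 : (fun k => a 1 * q k) @ \oo --> 0.
  by rewrite -(mulr0 (a 1)); apply: cvgMr; exact: cvg_q.
have [k [k1 k2]] : exists k, `|L - phi k| < e / 3 /\ a 1 * q k < e / 3.
  near \oo => k; exists k; split; near: k.
    by move/cvgrPdist_lt: cvg_phi; exact.
  exact: cvgr_lt c1 _ e3.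
near=> m.
have : `|phi k - G (m %/ p ^ k)%N m / m%:R| < e / 3.
  by near: m; move/cvgrPdist_lt: (@cvg_G_divn k); exact.
have m0 : 0 < m%:R :> R by rewrite ltr0n; near: m; exists 1%N.
have /G_head : (m %/ p ^ k <= m)%N by rewrite leq_div.
set n := (m %/ p ^ k)%N; move=> /andP[g1 g2].
have n_le : n%:R <= q k * m%:R.
  by rewrite mulrC qVE ler_pdivlMr// -natrM ler_nat leq_trunc_div.
have g3 : 0 <= G 0 m / m%:R - G n m / m%:R <= a 1 * q k.
  rewrite -mulrBl divr_ge0//= ler_pdivrMr// (le_trans g2)// -mulrA ler_wpM2l//.
by move: k1; rewrite !ltr_norml; lra.
Unshelve. all: by end_near. Qed.

Lemma ex_speed h : limn (fun m => G 0 m / m%:R) <= h -> h <= a 1 ->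
  exists (tau : R) (f : nat -> nat),
    [/\ (fun m => (f m)%:R / m%:R : R) @ \oo --> tau,
        forall m, (f m.+1 < m.+1)%N &
        (fun m => G (f m) m / (m - f m)%:R) @ \oo --> h].
Proof.
rewrite (cvg_lim _ cvg_G0)// le_eqVlt => /predU1P[<- _|Lh ha].
  exists 0, (fun=> 0%N); split => //.
    by under eq_fun do rewrite mul0r; exact: cvg_cst.
  by under eq_fun do rewrite subn0; exact: cvg_G0.
(* For k > 0, [E k] is negative exactly when the limiting ratio phi k / (1 - q k) at tau = p^-k is
   below h; [E] tends to L - h < 0. *)
pose E k := phi k - h * (1 - q k).
have cE : E @ \oo --> L - h * (1 - 0).
  apply: cvgB; first exact: cvg_phi.
  by apply: cvgMr; apply: cvgB; [exact: cvg_cst|exact: cvg_q].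
have [|k Ek kmin] := @ex_minnP (fun k => E k < 0).
  near \oo => k; exists k; near: k; apply: cvgr_lt cE _ _.
  by rewrite subr0 mulr1 subr_lt0.
(* The first negative index is at least 2, since E 0 = 0 and E 1 = (a 1 - h)(1 - 1/p) >= 0. *)
case: k Ek kmin => [|[|j]] Ek kmin.
- by move: Ek; rewrite /E /phi big_ord0 /q expr0; lra.
- move: Ek; rewrite /E phiS /phi big_ord0 /d a_0 /q expr0 expr1.
  have := p_le_half; nra.
have Ej : 0 <= E j.+1 by rewrite leNgt; apply/negP => /kmin; rewrite ltnn.
pose D := d j.+1; pose P := q j.+1; pose Q := q j.+2; pose A := phi j.+1.
have EP : 0 <= A - h * (1 - P) by [].
have EQ : A + D * (P - Q) - h * (1 - Q) < 0 by move: Ek; rewrite /E phiS.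
have P0 : 0 < P by exact: q_gt0.
have Q0 : 0 < Q by exact: q_gt0.
have QP : Q <= P / 2 by exact: qS_le.
have P1 : P < 1.
  by rewrite /P /q exprn_ilt1 ?invr_ge0 ?ltW//; apply: le_lt_trans p_le_half _; lra.
(* Subtracting [EP] from [EQ] gives (D - h)(P - Q) < 0. *)
have Dh : 0 < h - D by nra.
(* The root of A + D(P - tau) = h(1 - tau); the signs of [E] at the two ends place it in [Q, P]. *)
pose tau := (h - A - D * P) / (h - D).
have tauE : tau * (h - D) = h - A - D * P by rewrite divfK// gt_eqF.
have tauP : tau <= P by rewrite -(ler_pM2r Dh); lra.
have tauQ : Q <= tau by rewrite -(ler_pM2r Dh); lra.
pose f m := Num.truncn (tau * m%:R).
have fP m : (f m)%:R <= tau * m%:R < (f m).+1%:R.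
  by apply: truncn_itv; rewrite mulr_ge0// (le_trans _ tauQ)// ltW.
have cf : (fun m => (f m)%:R / m%:R : R) @ \oo --> tau.
  apply: cvg_ratio_floor => m; have /andP[-> /=] := fP m.
  by rewrite -natr1 andbT; lra.
have fm m : (f m.+1 < m.+1)%N.
  rewrite -(ltr_nat R); have /andP[/le_lt_trans -> //] := fP m.+1.
  by rewrite -[ltRHS]mul1r ltr_pM2r//; lra.
exists tau, f; split => //.
(* From Q <= tau <= P, all integers above [f m] and up to m/p^(j+1) have level j+1. *)
have GE m : G (f m) m / m%:R = G (m %/ p ^ j.+1)%N m / m%:R +
    D * ((m %/ p ^ j.+1)%:R / m%:R - (f m)%:R / m%:R).
  have /andP[f1 f2] := fP m.
  rewrite (@G_level j.+1 m _ (m %/ p ^ j.+1)) ?leq_trunc_div//; first by rewrite -/D; ring.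
    rewrite -(ltr_nat R) natrM -ltr_pdivrMr// -qVE.
    by apply: le_lt_trans f2; rewrite mulrC ler_wpM2r.
  rewrite leq_divRL ?expn_gt0 ?(ltn_trans _ hp)// -(ler_nat R) natrM.
  rewrite -ler_pdivlMr// -qVE (le_trans f1)// mulrC ler_wpM2l//.
have cG : (fun m => G (f m) m / m%:R) @ \oo --> A + D * (P - tau).
  under eq_fun do rewrite GE; apply: cvgD; first exact: cvg_G_divn.
  by apply: cvgMr; apply: cvgB => //; exact: cvg_ratio_divn.
have t1 : 1 - tau != 0 by rewrite subr_eq0 gt_eqF//; lra.
have -> : h = (A + D * (P - tau)) / (1 - tau).
  by apply: (mulIf t1); rewrite divfK//; lra.
(* For positive m, numerator and denominator can both be divided by m, and the window length is a
   true difference. *)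
rewrite -cvg_shiftS.
have -> : (fun m => G (f m.+1) m.+1 / (m.+1 - f m.+1)%:R) = (fun m =>
   (G (f m.+1) m.+1 / m.+1%:R) / (1 - (f m.+1)%:R / m.+1%:R)).
  apply/funext => m; have m0 : m.+1%:R != 0 :> R by rewrite pnatr_eq0.
  have -> : 1 - (f m.+1)%:R / m.+1%:R = (m.+1 - f m.+1)%:R / m.+1%:R :> R.
    by rewrite natrB 1?ltnW// mulrBl divff.
  by rewrite invf_div mulrA divfK.
rewrite (cvg_shiftS (fun m => G (f m) m / m%:R / (1 - (f m)%:R / m%:R))).
apply: cvgM => //; apply: cvgV => //; apply: cvgB => //; exact: cvg_cst.
Unshelve. all: by end_near. Qed.

End Asymptotics.

(** * Logarithms of the pattern and block counts as an instance of the recursion *)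

Theorem theorem2p4 (R : realType) (p r : nat) (Omega : set (sequence_space r))
    (hp : (2 <= p)%N) (hOmega : subshift Omega) (h : R)
    (hlow : topological_entropy R (multiplicative_system p Omega) <= h)
    (hupp : h <= ln (#|blocks Omega 1|%:R)) :
  exists (tau : R) (f : nat -> nat),
    has_speed f tau /\
    has_boundary_complexity f (multiplicative_system p Omega) h.
Proof.
set X := multiplicative_system p Omega in hlow *.
pose G n m : R := ln #|patterns (window n m) X|%:R.
pose a k : R := ln #|blocks Omega k|%:R.
have X_gt0 n m : 0 < #|patterns (window n m) X|%:R :> R.
  by rewrite ltr0n card_patterns_gt0.
have b_gt0 k : 0 < #|blocks Omega k|%:R :> R by rewrite ltr0n card_blocks_gt0.
have G_nil m : G m m = 0 by rewrite /G card_patterns_window_nil// ln1.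
have a_0 : a 0 = 0 by rewrite /a card_blocks0// ln1.
have G_step n m k : (n.+1 * p ^ k <= m < n.+1 * p ^ k.+1)%N ->
    G n m = G n.+1 m + (a k.+1 - a k).
  move=> /(card_patterns_window_step hp hOmega)/(congr1 (fun i => ln i%:R : R)).
  by rewrite !natrM !lnM ?posrE// -/(G _ _) -/(G _ _) -/(a _) -/(a _); lra.
have a_ndecr k : a k <= a k.+1.
  by rewrite ler_ln ?posrE// ler_nat leq_card_blocksS.
have a_incr_le k : a k.+1 - a k <= a 1.
  rewrite lerBlDr -lnM ?posrE// -natrM ler_ln ?posrE//.
    by rewrite ler_nat card_blocksS_leq.
  by rewrite natrM mulr_gt0.
have entropyE : topological_entropy R X = limn (fun m => G 0 m / m%:R).
  congr (limn _); apply/funext => m; rewrite /G.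
  suff -> : window 0 m = interval1 m by [].
  by apply/fsetP => j; rewrite in_window !inE mem_iota add1n ltnS.
rewrite entropyE in hlow.
have [tau [f [ftau f_lt fh]]] :=
  ex_speed hp G_nil G_step a_0 a_ndecr a_incr_le hlow hupp.
exists tau, f; split=> //; split.
  exists 1%N => // -[//|m] _; rewrite -cardfs_gt0.
  by rewrite [X in (0 < X)%N]card_window subn_gt0 f_lt.
by under eq_fun do rewrite [X in _ / X%:R]card_window.
Qed.
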